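(* Consider a first order forward discretized nonlinear dynamical system with dual linear closure $$\hat{x}^{n+1} = \hat{x}^{n} + \Delta t\,(F(\hat{x}^{n}) + A_{12}\tilde{x}^{n}),\qquad \tilde{x}^{n+1} = \tilde{x}^{n} + \Delta t\,(H(\hat{x}^{n}) + A_{22}\tilde{x}^{n}),\qquad \delta^{n} = A_{12}\tilde{x}^{n}.$$ With $p = N-Q-1$, the system satisfies the rank test $$\operatorname{rank}(V_p) = \operatorname{rank}\left(\begin{bmatrix} C^\top \\ V_p^\top\end{bmatrix}\right), \qquad C^\top = \begin{bmatrix} A_{12}A_{22} & \mathbf{0}\end{bmatrix} \in \mathbb{R}^{Q\times (p+1)(N-Q)},$$ and the closure dynamics is observable from the $p$-time delayed observable space, i.e. it can be determined as a linear combination of $H(\hat{x}^{n-1}),\ldots,H(\hat{x}^{n-p}), \delta^n, \ldots, \delta^{n-p}$. Furthermore, the minimal number of previous steps $p\in\mathbb{N}$ for which the rank test $\operatorname{rank}(V_p) = \operatorname{rank}\left(\begin{bmatrix} C^\top \\ V_p^\top\end{bmatrix}\right)$ with $C^\top = \begin{bmatrix} A_{12}A_{22} & \mathbf{0}\end{bmatrix} \in \mathbb{R}^{Q\times (p+1)(N-Q)}$ is satisfied is $$p_{*} = \min \Pi_{\mathcal{O}} - 1, \qquad \Pi_{\mathcal{O}} = \{\, l\in\mathbb{N}^{+} : r_{\mathcal{O}}(l) = r_{\mathcal{O}}(l+1)\,\}.$$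
   Context: Here $N, Q$ are integers with $1 \le Q < N$, $\Delta t>0$, $\hat{x}^n\in\mathbb{R}^Q$ is the resolved state, $\tilde{x}^n\in\mathbb{R}^{N-Q}$ the unresolved state, $F:\mathbb{R}^Q\to\mathbb{R}^Q$, $H:\mathbb{R}^Q\to\mathbb{R}^{N-Q}$, $A_{12}\in\mathbb{R}^{Q\times(N-Q)}$, $A_{22}\in\mathbb{R}^{(N-Q)\times(N-Q)}$. For $k\in\mathbb{N}^+$, $\mathcal{O}_k = \begin{bmatrix} A_{12}\\ A_{12}A_{22}\\ \vdots\\ A_{12}A_{22}^{k-1}\end{bmatrix}\in\mathbb{R}^{kQ\times(N-Q)}$ and $r_{\mathcal{O}}(k)=\operatorname{rank}(\mathcal{O}_k)$. For $p\in\mathbb{N}$ let $X_p = [\tilde{x}^{n};\tilde{x}^{n-1};\ldots;\tilde{x}^{n-p}]\in\mathbb{R}^{(p+1)(N-Q)}$ (stacked column vector). Let $\Gamma_p\in\mathbb{R}^{(pN+Q)\times(p+1)(N-Q)}$ be the block matrix with block columns indexed $0,\ldots,p$ (each of width $N-Q$) whose first $p$ block rows ($i=0,\ldots,p-1$) have $I$ in block column $i$, $-(I+\Delta t A_{22})$ in block column $i+1$ and zeros elsewhere, and whose next $p+1$ block rows ($i=0,\ldots,p$) have $A_{12}$ in block column $i$ and zeros elsewhere. The evolution equations for $\tilde{x}$ and the relations $A_{12}\tilde{x}^{n-i}=\delta^{n-i}$ read $\Gamma_pX_p=\Sigma_p$ with $\Sigma_p=[\Delta t H(\hat{x}^{n-1});\ldots;\Delta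 t H(\hat{x}^{n-p});\delta^n;\ldots;\delta^{n-p}]$. Let $\Gamma_p=U_pS_pV_p^\top$ be the reduced singular value decomposition, with $V_p\in\mathbb{R}^{(p+1)(N-Q)\times r}$, $r=\operatorname{rank}(\Gamma_p)$. The $p$-time delayed linear observable space is $\chi_p=\{\eta : \eta=v^\top X_p,\ v\in\operatorname{Im}V_p\}$, where elements are regarded as linear functionals of $X_p$; a vector quantity $C^\top X_p$ is in $\chi_p$ (is observable) if each of its components is. The exact closure dynamics is $\delta^{n+1}=\delta^n+\Delta t\,(A_{12}A_{22}\tilde{x}^n+A_{12}H(\hat{x}^n))$, whose only unknown is $A_{12}A_{22}\tilde{x}^n$; ''the closure dynamics is observable / can be determined'' means that $A_{12}A_{22}\tilde{x}^n = C^\top X_p$ is in $\chi_p$, i.e. equals a combination, with constant matrix coefficients, of the listed vectors whenever $\Gamma_pX_p=\Sigma_p$. *)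

(* Defs.v *)
From HB Require Import structures.
From mathcomp Require Import all_boot all_order all_algebra.
From mathcomp Require Import classical_sets reals.
Set Implicit Arguments. Unset Strict Implicit. Unset Printing Implicit Defensive.
Import Order.TTheory GRing.Theory Num.Theory.
Local Open Scope classical_set_scope.
Local Open Scope ring_scope.

(* Throughout, q = Q is the dimension of the resolved state and m = N - Q that
   of the unresolved state.  Block matrices have dimensions of the form
   \sum_(i < k) m, the block-structured form of k * m. *)

Definition dual_linear_system (R : realType) (q m : nat) (dt : R)
    (F : 'cV[R]_q -> 'cV[R]_q) (H : 'cV[R]_q -> 'cV[R]_m)
    (A12 : 'M[R]_(q, m)) (A22 : 'M[R]_m)
    (xhat : nat -> 'cV[R]_q) (xtilde : nat -> 'cV[R]_m)
    (delta : nat -> 'cV[R]_q) : Prop :=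
  forall n : nat,
    [/\ xhat n.+1 = xhat n + dt *: (F (xhat n) + A12 *m xtilde n),
        xtilde n.+1 = xtilde n + dt *: (H (xhat n) + A22 *m xtilde n)
      & delta n = A12 *m xtilde n].

Definition obs_mx (R : realType) (q m : nat) (A12 : 'M[R]_(q, m))
    (A22 : 'M[R]_m) (k : nat) : 'M[R]_(\sum_(i < k) q, m) :=
  \mxcol_(i < k) (A12 *m A22 ^+ i).

Definition Pi_obs (R : realType) (q m : nat) (A12 : 'M[R]_(q, m))
    (A22 : 'M[R]_m) : set nat :=
  [set l | (0 < l)%N /\ \rank (obs_mx A12 A22 l) = \rank (obs_mx A12 A22 l.+1)].

Definition is_min (P : set nat) (k : nat) : Prop :=
  P k /\ forall j : nat, P j -> (k <= j)%N.

(* The subtraction n - i is truncated; it is only meant for p <= n. *)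
Definition delay_vec (R : realType) (m : nat) (xtilde : nat -> 'cV[R]_m)
    (n p : nat) : 'cV[R]_(\sum_(i < p.+1) m) :=
  \mxcol_(i < p.+1) xtilde (n - i)%N.

Definition Gamma (R : realType) (q m : nat) (dt : R) (A12 : 'M[R]_(q, m))
    (A22 : 'M[R]_m) (p : nat) :
    'M[R]_(\sum_(i < p) m + \sum_(i < p.+1) q, \sum_(j < p.+1) m) :=
  col_mx
    (\mxblock_(i < p, j < p.+1)
       (if j == i :> nat then 1%:M
        else if j == i.+1 :> nat then - (1%:M + dt *: A22)
        else 0))
    (\mxblock_(i < p.+1, j < p.+1) (if j == i then A12 else 0)).

Definition Sigma (R : realType) (q m : nat) (dt : R)
    (H : 'cV[R]_q -> 'cV[R]_m) (xhat delta : nat -> 'cV[R]_q) (n p : nat) :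
    'cV[R]_(\sum_(i < p) m + \sum_(i < p.+1) q) :=
  col_mx (\mxcol_(i < p) (dt *: H (xhat (n - i.+1)%N)))
         (\mxcol_(i < p.+1) delta (n - i)%N).

(* The matrix written C^T in [C^T; V_p^T], i.e. [A12 A22, 0]. *)
Definition closure_row (R : realType) (q m : nat) (A12 : 'M[R]_(q, m))
    (A22 : 'M[R]_m) (p : nat) : 'M[R]_(q, \sum_(j < p.+1) m) :=
  \mxrow_(j < p.+1) (if j == ord0 then A12 *m A22 else 0).

(* The singular values are not required to be sorted. *)
Definition is_reduced_svd (R : realType) (k l : nat) (G : 'M[R]_(k, l))
    (U : 'M[R]_(k, \rank G)) (S : 'M[R]_(\rank G)) (V : 'M[R]_(l, \rank G)) :
    Prop :=
  [/\ G = U *m S *m V^T,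
      U^T *m U = 1%:M,
      V^T *m V = 1%:M,
      is_diag_mx S
    & forall i, 0 < S i i].

Definition rank_test (R : realType) (q l r : nat) (CT : 'M[R]_(q, l))
    (V : 'M[R]_(l, r)) : Prop :=
  \rank V = \rank (col_mx CT V^T).

Definition observable_space (R : realType) (l r : nat) (V : 'M[R]_(l, r)) :
    set ('cV[R]_l -> R) :=
  [set eta | exists v : 'cV[R]_l,
     (exists w : 'cV[R]_r, v = V *m w) /\
     forall X : 'cV[R]_l, eta X = (v^T *m X) 0 0].

Definition observable (R : realType) (q l r : nat) (V : 'M[R]_(l, r))
    (f : 'cV[R]_l -> 'cV[R]_q) : Prop :=
  forall i : 'I_q, observable_space V (fun X => f X i 0).

Definition closure_comb (R : realType) (q m p : nat)
    (H : 'cV[R]_q -> 'cV[R]_m) (xhat delta : nat -> 'cV[R]_q) (n : nat)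
    (K : 'I_p -> 'M[R]_(q, m)) (L : 'I_p.+1 -> 'M[R]_q) : 'cV[R]_q :=
  \sum_(i < p) K i *m H (xhat (n - i.+1)%N)
    + \sum_(i < p.+1) L i *m delta (n - i)%N.

(* Main.v *)
Require Import Defs.
From HB Require Import structures.
From mathcomp Require Import all_boot all_order all_algebra.
From mathcomp Require Import classical_sets reals.

(** Write m = N - Q for the number of unresolved states and
    M = 1 + dt A22 for their one-step propagator.

    By orthonormality of its columns, [V_p] spans the row space of [Gamma_p],
    so the rank test says that the rows of [C^T] lie in the row space of
    [Gamma_p] ([rank_test_svd]), or dually that [C^T] vanishes on the kernel of
    [Gamma_p] ([submx_kerP]).  That kernel is explicit: its first block rows
    force an element to be a trajectory M^p z, ..., M z, z of the homogeneous
    dynamics, and its last ones force A12 M^j z = 0 for all j <= p.  On it,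
    dt C^T X = A12 (M - 1) M^p z = A12 M^(p+1) z.  Hence the test at p holds
    exactly when A12 M^j z = 0 for j <= p implies A12 M^(p+1) z = 0
    ([closure_row_sub_Gamma]).

    Powers of M up to order k and powers of A22 up to order k have the same
    span ([unseen_propagator]), so M may be replaced by A22, and the condition
    becomes: the kernel, hence the rank, of the observability matrix does not
    change from p+1 to p+2 block rows ([rank_obs_mxP]).  Thus the test holds
    at p iff p + 1 belongs to Pi_O ([rank_test_Pi_obs]).  Cayley-Hamilton puts
    m in Pi_O ([Pi_obs_dim]), which gives the test at p = m - 1; and the least
    p passing the test is one less than the least element of Pi_O.

    Finally, when the rows of [C^T] lie in the row space of [Gamma_p], any
    factorisation C^T = D Gamma_p turns Gamma_p X_p = Sigma_p into
    A12 A22 x = D Sigma_p, and the blocks of D, those on H being scaled by dt,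
    are the coefficients of the closure ([closure_comb_of_factor]). *)

Set Implicit Arguments. Unset Strict Implicit. Unset Printing Implicit Defensive.
Import Order.TTheory GRing.Theory Num.Theory.
Local Open Scope classical_set_scope.
Local Open Scope ring_scope.

(** * Row spaces and kernels *)

(** Row-space inclusion is dual to kernel inclusion; the test matrices [Z] are
    allowed any width so that a cokernel, which is square, can be used. *)
Lemma submx_kerP (F : fieldType) (a b n : nat) (A : 'M[F]_(a, n))
    (B : 'M[F]_(b, n)) :
  (A <= B)%MS <->
  (forall k (Z : 'M[F]_(n, k)), B *m Z = 0 -> A *m Z = 0).
Proof.
split=> [/submxP[D ->] k Z BZ|kerBA]; first by rewrite -mulmxA BZ mulmx0.
by rewrite submxE; apply/eqP/kerBA/mulmx_coker.
Qed.

(** [G = (U S) V^T] puts the rows of [G] in the span of those of [V^T], and the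
    orthonormality of the columns of [V] makes the two ranks equal. *)
Lemma svd_row_space (R : realType) (k l : nat) (G : 'M[R]_(k, l))
    (U : 'M_(k, \rank G)) (S : 'M_(\rank G)) (V : 'M_(l, \rank G)) :
  is_reduced_svd U S V -> (V^T :=: G)%MS.
Proof.
case=> defG _ VV _ _.
have rankV : \rank V = \rank G.
  apply/eqP; rewrite eqn_leq rank_leq_col -{1}(mxrank1 R (\rank G)) -VV.
  exact: mxrankM_maxr.
have sGV : (G <= V^T)%MS by apply/submxP; exists (U *m S).
by apply/eqmxP; rewrite -(mxrank_leqif_sup sGV) mxrank_tr rankV eqxx sGV.
Qed.

Lemma rank_test_svd (R : realType) (k l q : nat) (G : 'M[R]_(k, l))
    (U : 'M_(k, \rank G)) (S : 'M_(\rank G)) (V : 'M_(l, \rank G))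
    (CT : 'M[R]_(q, l)) :
  is_reduced_svd U S V -> rank_test CT V <-> (CT <= G)%MS.
Proof.
move=> /svd_row_space defV.
have <- : (CT <= V^T)%MS = (CT <= G)%MS by rewrite defV.
rewrite /rank_test -(mxrank_tr V) -addsmxE.
have := mxrank_leqif_sup (addsmxSr CT V^T).
rewrite addsmx_sub submx_refl andbT => rankP; split=> [eq_rank|sCV].
  by rewrite -rankP eq_rank.
by apply/eqP; rewrite rankP.
Qed.

Lemma observable_svd (R : realType) (k l q : nat) (G : 'M[R]_(k, l))
    (U : 'M_(k, \rank G)) (S : 'M_(\rank G)) (V : 'M_(l, \rank G))
    (CT : 'M[R]_(q, l)) :
  is_reduced_svd U S V -> (CT <= G)%MS -> observable V (fun X => CT *m X).
Proof.
move=> /svd_row_space defV sCG.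
have /submxP[W defC] : (CT <= V^T)%MS by rewrite defV.
move=> i; exists (V *m (row i W)^T); split; first by exists (row i W)^T.
by move=> X; rewrite trmx_mul trmxK -row_mul -defC -row_mul [RHS]mxE.
Qed.

(** * Unobservable directions of a linear dynamics *)

(** The columns of [Z] are invisible to the output [C x] during the first [k]
    steps of the dynamics [x |-> A x]: the kernel of the observability
    matrix. *)
Definition unseen (R : realType) (q m k : nat) (C : 'M[R]_(q, m))
    (A : 'M[R]_m) (l : nat) (Z : 'M[R]_(m, l)) : Prop :=
  forall i, (i < k)%N -> C *m A ^+ i *m Z = 0.

Lemma obs_mx_unseen (R : realType) (q m k l : nat) (C : 'M[R]_(q, m))
    (A : 'M[R]_m) (Z : 'M[R]_(m, l)) :
  obs_mx C A k *m Z = 0 <-> unseen k C A Z.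
Proof.
rewrite /obs_mx mxcol_mul; split=> [/mxcolP eq0 i lt_ik|CAZ].
  by have := eq0 (Ordinal lt_ik); rewrite mxcolK submxcol0.
by apply/mxcolP=> i; rewrite mxcolK submxcol0 CAZ.
Qed.

Lemma rank_obs_mxP (R : realType) (q m k : nat) (C : 'M[R]_(q, m))
    (A : 'M[R]_m) :
  \rank (obs_mx C A k) = \rank (obs_mx C A k.+1) <->
  (forall l (Z : 'M[R]_(m, l)), unseen k C A Z -> C *m A ^+ k *m Z = 0).
Proof.
have sub_obs : (obs_mx C A k <= obs_mx C A k.+1)%MS.
  apply/submx_kerP=> l Z /obs_mx_unseen CAZ; apply/obs_mx_unseen=> i lt_ik.
  exact/CAZ/ltnW.
apply: iff_trans (_ : (obs_mx C A k.+1 <= obs_mx C A k)%MS <-> _).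
  by rewrite -(mxrank_leqif_sup sub_obs).2; split=> [->|/eqP].
rewrite submx_kerP; split=> stable l Z.
  by move=> /obs_mx_unseen/stable/obs_mx_unseen; apply.
move=> /obs_mx_unseen CAZ; apply/obs_mx_unseen=> i.
rewrite ltnS leq_eqVlt => /predU1P[->|]; [exact: stable | exact: CAZ].
Qed.

Lemma unseen_horner (R : realType) (q m k l : nat) (C : 'M[R]_(q, m.+1))
    (A : 'M[R]_m.+1) (Z : 'M[R]_(m.+1, l)) (P : {poly R}) :
  unseen k C A Z -> (size P <= k)%N -> C *m horner_mx A P *m Z = 0.
Proof.
move=> CAZ leP; rewrite -[P]coefK poly_def rmorph_sum mulmx_sumr mulmx_suml.
rewrite big1 // => i _; rewrite /= -mul_polyC rmorphM rmorphXn /=.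
rewrite horner_mx_C horner_mx_X -mulmxE mul_scalar_mx -scalemxAr.
by rewrite -scalemxAl CAZ ?scaler0 // (leq_trans (ltn_ord i)).
Qed.

(** The i-th power of an affine function of [A] is a polynomial of degree at
    most i in [A], so such a change of matrix does not enlarge the span of the
    first [k] powers. *)
Lemma unseen_affine (R : realType) (q m k l : nat) (C : 'M[R]_(q, m.+1))
    (A : 'M[R]_m.+1) (Z : 'M[R]_(m.+1, l)) (a b : R) :
  unseen k C A Z -> unseen k C (a%:M + b *: A) Z.
Proof.
move=> CAZ i lt_ik.
have -> : (a%:M + b *: A) ^+ i = horner_mx A ((a%:P + b *: 'X) ^+ i).
  rewrite rmorphXn rmorphD /= -mul_polyC rmorphM /= !horner_mx_C horner_mx_X.
  by rewrite -mulmxE mul_scalar_mx.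
apply: (unseen_horner CAZ); apply: leq_trans (size_poly_exp_leq _ _) _.
apply: leq_ltn_trans lt_ik; rewrite -{2}[i]mul1n leq_mul2r; apply/orP; right.
have szP : (size (a%:P + b *: 'X)%R <= 2)%N.
  rewrite (leq_trans (size_polyD _ _)) // geq_max.
  rewrite (leq_trans (size_polyC_leq1 _)) //=.
  by rewrite (leq_trans (size_scale_leq _ _)) // size_polyX.
by case: (size _) szP => [|[|[]]].
Qed.

Lemma unseen_propagator (R : realType) (q m k l : nat) (dt : R)
    (C : 'M[R]_(q, m.+1)) (A : 'M[R]_m.+1) (Z : 'M[R]_(m.+1, l)) :
  dt != 0 -> unseen k C (1%:M + dt *: A) Z <-> unseen k C A Z.
Proof.
move=> dt0; split; last exact: unseen_affine.
move=> /(unseen_affine (- dt^-1) dt^-1).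
rewrite scalerDr scalerA mulVf // scale1r scale_scalar_mx mulr1.
by rewrite addrA -raddfD /= addNr raddf0 add0r.
Qed.

(** By Cayley-Hamilton, [A ^+ m.+1] is a combination of the lower powers. *)
Lemma Pi_obs_dim (R : realType) (q m : nat) (C : 'M[R]_(q, m.+1))
    (A : 'M[R]_m.+1) : Pi_obs C A m.+1.
Proof.
split=> //; apply/rank_obs_mxP=> l Z CAZ.
have -> : A ^+ m.+1 = horner_mx A ('X^(m.+1) - char_poly A).
  by rewrite rmorphB rmorphXn /= horner_mx_X Cayley_Hamilton subr0.
apply: (unseen_horner CAZ).
(* both terms are monic of degree [m.+1], so their leading terms cancel *)
apply/leq_sizeP=> j le_mj; rewrite coefB coefXn.
case: (ltngtP j m.+1) le_mj => [//|lt_mj|->] _.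
  by rewrite (nth_default _ _) ?subr0 // size_char_poly.
have := char_poly_monic A; rewrite monicE lead_coefE size_char_poly /=.
by move=> /eqP->; rewrite subrr.
Qed.

(** * The delay equations *)

(** Blocks are indexed by [nat] so that consecutive blocks [x i], [x i.+1] can
    be named without casts between ordinal types. *)
Lemma Gamma_mxcol (R : realType) (q m k : nat) (dt : R) (A12 : 'M[R]_(q, m))
    (A22 : 'M[R]_m) (p : nat) (x : nat -> 'M[R]_(m, k)) :
  Gamma dt A12 A22 p *m (\mxcol_(j < p.+1) x j) =
  col_mx (\mxcol_(i < p) (x i - (1%:M + dt *: A22) *m x i.+1))
         (\mxcol_(i < p.+1) (A12 *m x i)).
Proof.
rewrite /Gamma mul_col_mx !mul_mxblock_mxrow.
congr col_mx; apply: eq_mxcol => i.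
  have lt_ip : (i < p.+1)%N by apply: ltnW; rewrite ltnS.
  have lt_i1p : (i.+1 < p.+1)%N by rewrite ltnS.
  rewrite (bigD1 (Ordinal lt_ip)) //= eqxx mul1mx; congr (_ + _).
  rewrite (bigD1 (Ordinal lt_i1p)) /=; last by rewrite -val_eqE /= gtn_eqF.
  rewrite gtn_eqF // eqxx mulNmx big1 ?addr0 // => j /andP[].
  by rewrite -!val_eqE /= => /negbTE-> /negbTE->; rewrite mul0mx.
rewrite (bigD1 i) //= eqxx big1 ?addr0 // => j /negbTE->.
by rewrite mul0mx.
Qed.

Lemma closure_row_mxcol (R : realType) (q m k : nat) (A12 : 'M[R]_(q, m))
    (A22 : 'M[R]_m) (p : nat) (x : nat -> 'M[R]_(m, k)) :
  closure_row A12 A22 p *m (\mxcol_(j < p.+1) x j) = A12 *m A22 *m x 0%N.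
Proof.
rewrite /closure_row mul_mxrow_mxcol (bigD1 ord0) //= big1 ?addr0 // => j.
by move=> /negbTE->; rewrite mul0mx.
Qed.

Lemma mxcol_nat (R : realType) (m k p : nat)
    (X : 'M[R]_(\sum_(j < p.+1) m, k)) :
  exists x : nat -> 'M[R]_(m, k), X = \mxcol_(j < p.+1) x j.
Proof.
exists (fun j => submxcol X (inord j)).
by apply/mxcolP=> i; rewrite mxcolK inord_val.
Qed.

(** The kernel of [Gamma]: trajectories, listed backwards in time, whose
    outputs vanish. *)
Lemma Gamma_kerP (R : realType) (q m k : nat) (dt : R) (A12 : 'M[R]_(q, m))
    (A22 : 'M[R]_m) (p : nat) (x : nat -> 'M[R]_(m, k)) :
  Gamma dt A12 A22 p *m (\mxcol_(j < p.+1) x j) = 0 <->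
  (forall j, (j <= p)%N -> x (p - j)%N = (1%:M + dt *: A22) ^+ j *m x p) /\
  unseen p.+1 A12 (1%:M + dt *: A22) (x p).
Proof.
set M := 1%:M + _; rewrite Gamma_mxcol -/M -col_mx0.
split=> [/eq_col_mx[/mxcolP dyn /mxcolP out]|[dyn out]].
  have traj j : (j <= p)%N -> x (p - j)%N = M ^+ j *m x p.
    elim: j => [|j IHj] lt_jp; first by rewrite subn0 expr0 mul1mx.
    have lt_p : (p - j.+1 < p)%N by rewrite ltn_subrL (leq_trans _ lt_jp).
    have := dyn (Ordinal lt_p); rewrite mxcolK submxcol0 => /subr0_eq /= ->.
    by rewrite subnSK // IHj 1?ltnW // exprS mulmxA.
  split=> // i; rewrite ltnS => le_ip; rewrite -mulmxA -traj //.
  have lt_p : (p - i < p.+1)%N by rewrite ltnS leq_subr.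
  by have := out (Ordinal lt_p); rewrite mxcolK submxcol0.
have traj j : (j <= p)%N -> x j = M ^+ (p - j) *m x p.
  by move=> le_jp; rewrite -{1}(subKn le_jp) dyn ?leq_subr.
congr col_mx; apply/mxcolP=> i; rewrite mxcolK submxcol0.
  rewrite (traj i.+1) // (traj i) 1?ltnW // mulmxA [in M *m _]mulmxE -exprS.
  by rewrite subnSK // subrr.
rewrite traj -1?ltnS // mulmxA.
by apply: out; rewrite ltnS leq_subr.
Qed.

(** On the kernel of [Gamma], [dt] times the closure term is the next output
    [A12 M^(p+1) z], because [dt *: A22] is [M - 1] and [A12 M^p z = 0]. *)
Lemma closure_row_sub_Gamma (R : realType) (q m : nat) (dt : R)
    (A12 : 'M[R]_(q, m)) (A22 : 'M[R]_m) (p : nat) :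
  dt != 0 ->
  let M := 1%:M + dt *: A22 in
  (closure_row A12 A22 p <= Gamma dt A12 A22 p)%MS <->
  (forall l (Z : 'M[R]_(m, l)),
     unseen p.+1 A12 M Z -> A12 *m M ^+ p.+1 *m Z = 0).
Proof.
move=> dt0 M.
have next l (Z : 'M[R]_(m, l)) : unseen p.+1 A12 M Z ->
    dt *: (A12 *m A22 *m (M ^+ p *m Z)) = A12 *m M ^+ p.+1 *m Z.
  move=> /(_ p (leqnn _)) out_p.
  rewrite exprS -mulmxE {2}/M mulmxDl mul1mx mulmxDr mulmxDl out_p add0r.
  by rewrite -!scalemxAl -scalemxAr -scalemxAl !mulmxA.
rewrite submx_kerP; split=> [kerGC l Z outZ|stable l X].
  pose x j := M ^+ (p - j) *m Z.
  have xp : x p = Z by rewrite /x subnn expr0 mul1mx.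
  have /kerGC : Gamma dt A12 A22 p *m (\mxcol_(j < p.+1) x j) = 0.
    by apply/Gamma_kerP; rewrite xp; split=> // j le_jp; rewrite /x subKn.
  rewrite closure_row_mxcol {1}/x subn0 => closed.
  by rewrite -next // closed scaler0.
have [x ->] := mxcol_nat X; move=> /Gamma_kerP[traj outx].
rewrite closure_row_mxcol -(subnn p) traj // -/M.
apply: (scalerI dt0); rewrite scaler0 next //; exact: stable.
Qed.

(** Both sides say that directions unseen for [p.+1] steps stay unseen for one
    more, on the left for the propagator and on the right for [A22]; the two
    notions of unseen agree for every number of steps. *)
Lemma rank_test_Pi_obs (R : realType) (q m : nat) (dt : R)
    (A12 : 'M[R]_(q, m.+1)) (A22 : 'M[R]_m.+1) (p : nat)
    (U : 'M_(_, \rank (Gamma dt A12 A22 p))) S V :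
  dt != 0 -> is_reduced_svd U S V ->
  rank_test (closure_row A12 A22 p) V <-> Pi_obs A12 A22 p.+1.
Proof.
move=> dt0 svd; rewrite (rank_test_svd _ svd) closure_row_sub_Gamma //.
have propE k l (Z : 'M_(m.+1, l)) := unseen_propagator k A12 A22 Z dt0.
have stepE k (B : 'M[R]_m.+1) l (Z : 'M[R]_(m.+1, l)) :
    unseen k.+1 A12 B Z <-> unseen k A12 B Z /\ A12 *m B ^+ k *m Z = 0.
  split=> [outZ|[outZ outk] i]; first by split=> [i /ltnW|]; apply: outZ.
  by rewrite ltnS leq_eqVlt => /predU1P[->|/outZ].
split=> [stable|[_ /rank_obs_mxP stable] l Z outZ].
  split=> //; apply/rank_obs_mxP=> l Z /propE outZ.
  have /propE/stepE[] // : unseen p.+2 A12 (1%:M + dt *: A22) Z.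
  by apply/stepE; split=> //; apply: stable.
have /propE/stepE[] // : unseen p.+2 A12 A22 Z.
have outZ' : unseen p.+1 A12 A22 Z by apply/propE.
by apply/stepE; split=> //; apply: stable.
Qed.

(** * Closing the resolved dynamics *)

Lemma dual_system_Gamma (R : realType) (q m : nat) (dt : R) F
    (H : 'cV[R]_q -> 'cV[R]_m) A12 A22 xhat xtilde delta (n p : nat) :
  dual_linear_system dt F H A12 A22 xhat xtilde delta -> (p <= n)%N ->
  Gamma dt A12 A22 p *m delay_vec xtilde n p = Sigma dt H xhat delta n p.
Proof.
move=> sys le_pn.
rewrite /delay_vec (Gamma_mxcol _ _ _ _ (fun i => xtilde (n - i)%N)).
congr col_mx; apply: eq_mxcol => i; last by have [_ _ ->] := sys (n - i)%N.
have lt_in : (i < n)%N by apply: leq_trans le_pn.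
have [_ + _] := sys (n - i.+1)%N; rewrite subnSK // => ->.
rewrite mulmxDl mul1mx -scalemxAl scalerDr [_ *: H _ + _]addrC addrA.
by rewrite [LHS]addrC addKr.
Qed.

(** The first block column of a left factor multiplies [dt *: H] in [Sigma],
    whence the factor [dt] in the coefficients of [H]. *)
Lemma closure_comb_of_factor (R : realType) (q m p : nat) (dt : R)
    (H : 'cV[R]_q -> 'cV[R]_m) A12 A22
    (D : 'M[R]_(q, \sum_(i < p) m + \sum_(i < p.+1) q))
    xhat xtilde delta (n : nat) :
  closure_row A12 A22 p = D *m Gamma dt A12 A22 p ->
  Gamma dt A12 A22 p *m delay_vec xtilde n p = Sigma dt H xhat delta n p ->
  A12 *m A22 *m xtilde n =
    closure_comb H xhat delta n (fun i => dt *: submxrow (lsubmx D) i)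
                                (fun i => submxrow (rsubmx D) i).
Proof.
move=> defC eqS.
have := closure_row_mxcol A12 A22 p (fun i => xtilde (n - i)%N).
rewrite subn0 => <-; rewrite defC -mulmxA -/(delay_vec xtilde n p) eqS.
rewrite -{1}[D]hsubmxK mul_row_col -{1}[lsubmx D]submxrowK.
rewrite -{1}[rsubmx D]submxrowK !mul_mxrow_mxcol; congr (_ + _).
by apply: eq_bigr => i _; rewrite -scalemxAl -scalemxAr.
Qed.

Theorem theorem5p6 (R : realType) (N Q : nat) (hQ : (1 <= Q)%N)
    (hQN : (Q < N)%N) (dt : R) (hdt : 0 < dt)
    (F : 'cV[R]_Q -> 'cV[R]_Q) (H : 'cV[R]_Q -> 'cV[R]_(N - Q))
    (A12 : 'M[R]_(Q, N - Q)) (A22 : 'M[R]_(N - Q))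
    (U : forall p : nat,
       'M[R]_(\sum_(i < p) (N - Q) + \sum_(i < p.+1) Q,
              \rank (Gamma dt A12 A22 p)))
    (S : forall p : nat, 'M[R]_(\rank (Gamma dt A12 A22 p)))
    (V : forall p : nat,
       'M[R]_(\sum_(j < p.+1) (N - Q), \rank (Gamma dt A12 A22 p)))
    (hsvd : forall p : nat, is_reduced_svd (U p) (S p) (V p)) :
  (let p := (N - Q - 1)%N in
   [/\ rank_test (closure_row A12 A22 p) (V p),
       observable (V p) (fun X => closure_row A12 A22 p *m X)
     & exists (K : 'I_p -> 'M[R]_(Q, N - Q)) (L : 'I_p.+1 -> 'M[R]_Q),
         (forall (xhat : nat -> 'cV[R]_Q) (xtilde : nat -> 'cV[R]_(N - Q))
            (delta : nat -> 'cV[R]_Q) (n : nat), (p <= n)%N ->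
            Gamma dt A12 A22 p *m delay_vec xtilde n p
              = Sigma dt H xhat delta n p ->
            A12 *m A22 *m xtilde n = closure_comb H xhat delta n K L) /\
         (forall (xhat : nat -> 'cV[R]_Q) (xtilde : nat -> 'cV[R]_(N - Q))
            (delta : nat -> 'cV[R]_Q),
            dual_linear_system dt F H A12 A22 xhat xtilde delta ->
            forall n : nat, (p <= n)%N ->
            A12 *m A22 *m xtilde n = closure_comb H xhat delta n K L /\
            delta n.+1 = delta n
              + dt *: (closure_comb H xhat delta n K L
                       + A12 *m H (xhat n)))]) /\
  (exists l : nat,
     is_min (Pi_obs A12 A22) l /\
     is_min [set p | rank_test (closure_row A12 A22 p) (V p)] (l - 1)%N).
Proof.
have dt0 : dt != 0 by rewrite gt_eqF.
have m_gt0 : (0 < N - Q)%N by rewrite subn_gt0.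
(* write [N - Q] as [m.+1]: matrices of that size form a nontrivial ring, in
   which polynomials can be evaluated *)
move: (N - Q)%N m_gt0 H A12 A22 U S V hsvd.
case=> // m _ H A12 A22 U S V hsvd; rewrite subSS subn0.
have testP p := rank_test_Pi_obs dt0 (hsvd p).
have test_m : rank_test (closure_row A12 A22 m) (V m).
  by apply/testP; apply: Pi_obs_dim.
split.
  have subC : (closure_row A12 A22 m <= Gamma dt A12 A22 m)%MS.
    by apply/(rank_test_svd _ (hsvd m)).
  split=> //; first exact: (observable_svd (hsvd m)).
  have [D defC] := submxP subC.
  exists (fun i => dt *: submxrow (lsubmx D) i).
  exists (fun i => submxrow (rsubmx D) i).
  split=> [xh xt d n _|xh xt d sys n le_mn].
    exact: closure_comb_of_factor.
  have closed := closure_comb_of_factor defC (dual_system_Gamma sys le_mn).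
  split=> //; rewrite -closed.
  have [_ _ ->] := sys n.+1; have [_ -> _] := sys n; have [_ _ ->] := sys n.
  by rewrite mulmxDr -scalemxAr mulmxDr mulmxA [_ *m H _ + _]addrC.
pose Pib l :=
  (0 < l)%N && (\rank (obs_mx A12 A22 l) == \rank (obs_mx A12 A22 l.+1)).
have PibP l : Pi_obs A12 A22 l <-> Pib l.
  by split=> [[l0 /eqP ?]|/andP[? /eqP]]; first exact/andP.
have exPi : exists l, Pib l by exists m.+1; apply/PibP; apply: Pi_obs_dim.
case: (ex_minnP exPi) => l /PibP Pl min_l; exists l; split.
  by split=> // j /PibP/min_l.
case: l Pl min_l => [[]//|l] Pl min_l; rewrite subSS subn0.
split; first exact/testP.
by move=> j /testP/PibP/min_l.
Qed.
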